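(* Let $C$ be a cycle code with Tanner graph $G = (X \cup U, E)$ and fundamental polytope $\mathcal{P}$. If $\omega \in \mathcal{P}$ is a linear programming pseudocodeword of $\mathcal{P}$ (i.e., an extreme point of $\mathcal{P}$), then the following two conditions hold: (a) $\omega \in \{0,\tfrac12,1\}^{|X|}$, and (b) with $\mathcal{H} := \{x \in X \mid \omega_x = \tfrac12\}$, the subgraph $\Gamma$ of $G$ induced by $\mathcal{H} \cup N(\mathcal{H})$ is 2-regular. Equivalently, $\Gamma$ is a union of vertex-disjoint simple cycles $\gamma_1, \gamma_2, \dots, \gamma_\ell$.
   Context: A code is a binary linear code equipped with a fixed parity-check matrix $H$ (a binary matrix); it is a cycle code if every column of $H$ has exactly two entries equal to 1. The Tanner graph $G=(X\cup U,E)$ of the code is the bipartite graph whose variable nodes $X$ are the columns of $H$ and whose check nodes $U$ are the rows of $H$, with $x\in X$ adjacent to $u\in U$ iff $h_{u,x}=1$. $N(v)$ is the neighborhood of a node $v$ in $G$, and $N(A)=\bigcup_{v\in A}N(v)$ for a set $A$ of nodes. The fundamental polytope $\mathcal{P}=\mathcal{P}(H)$ is the set of all $f\in\mathbb{R}^{|X|}$ (coordinates indexed by $X$) satisfying $0\le f_x\le 1$ for all $x\in X$, and $\sum_{x\in S} f_x+\sum_{x\in N(u)\setminus S}(1-f_x)\le |N(u)|-1$ for all $u\in U$ and all $S\subseteq N(u)$ with $|S|$ odd. A linear programming pseudocodeword is an extreme point of $\mathcal{P}$. A graph is 2-regular if every vertex has degree exactly 2; the empty graph (the case $\mathcal{H}=\emptyset$,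 $\ell=0$) counts as 2-regular. *)

(* Defs.v *)
From mathcomp Require Import all_boot all_order all_algebra.
From mathcomp Require Import reals.

Set Implicit Arguments.
Unset Strict Implicit.
Unset Printing Implicit Defensive.

Import Order.TTheory GRing.Theory Num.Theory.
Local Open Scope ring_scope.

Section Graph.
Variables (V : finType) (e : rel V).

Definition nbhd (v : V) : {set V} := [set w | e v w].

Definition nbhds (A : {set V}) : {set V} := \bigcup_(v in A) nbhd v.

Definition induced (W : {set V}) : rel V :=
  [rel v w | [&& v \in W, w \in W & e v w]].

End Graph.

(* In the next three definitions a graph is given by its vertex set [W] and its
   adjacency relation [g] on [W]. *)

Definition two_regular (V : finType) (W : {set V}) (g : rel V) : Prop :=
  forall v, v \in W -> #|[set w in W | g v w]| = 2%N.

Definition simple_cycle (V : finType) (g : rel V) (c : seq V) : bool :=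
  [&& (2 < size c)%N, uniq c & cycle g c].

(* [uniq (flatten cs)] makes the cycles vertex-disjoint; the last two clauses
   say that the vertices and the edges of the graph are exactly those of the
   cycles. [cs = [::]] is allowed and forces [W] to be empty. *)
Definition disjoint_cycle_union (V : finType) (W : {set V}) (g : rel V)
    (cs : seq (seq V)) : Prop :=
  [/\ all (simple_cycle g) cs,
      uniq (flatten cs),
      forall v, (v \in W) = has (fun c => v \in c) cs
    & forall v w, g v w =
        has (fun c => [&& v \in c, w \in c & (next c v == w) || (next c w == v)])
            cs].

Section Code.
Variables (m n : nat) (H : 'M['F_2]_(m, n)).

Definition is_cycle_code : Prop :=
  forall x : 'I_n, #|[set u : 'I_m | H u x == 1]| = 2%N.

(* Nodes: [inl x] is the variable node of column [x], [inr u] the check node of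
   row [u]. *)
Definition tanner : rel ('I_n + 'I_m)%type := fun v w =>
  match v, w with
  | inl x, inr u | inr u, inl x => H u x == 1
  | _, _ => false
  end.

(* N(u) for a check node u, as a set of columns. *)
Definition check_nbhd (u : 'I_m) : {set 'I_n} :=
  [set x | inl x \in nbhd tanner (inr u)].

Definition fundamental_polytope (R : realType) (f : 'rV[R]_n) : Prop :=
  (forall x, 0 <= f 0 x <= 1) /\
  (forall (u : 'I_m) (S : {set 'I_n}), S \subset check_nbhd u -> odd #|S| ->
     \sum_(x in S) f 0 x + \sum_(x in check_nbhd u :\: S) (1 - f 0 x)
       <= #|check_nbhd u|%:R - 1).

End Code.

Definition extreme_point (R : realType) (n : nat) (P : 'rV[R]_n -> Prop)
    (w : 'rV[R]_n) : Prop :=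
  P w /\
  forall (f g : 'rV[R]_n) (t : R), P f -> P g -> 0 < t < 1 ->
    w = t *: f + (1 - t) *: g -> f = w /\ g = w.

Definition lp_pseudocodeword (m n : nat) (H : 'M['F_2]_(m, n)) (R : realType)
    (w : 'rV[R]_n) : Prop :=
  extreme_point (@fundamental_polytope m n H R) w.

(* The variable nodes at which [w] takes the value 1/2. *)
Definition half_nodes (m n : nat) (R : realType) (w : 'rV[R]_n) :
    {set 'I_n + 'I_m} :=
  [set inl x | x : 'I_n & w 0 x == 2^-1].

(* Main.v *)
Require Import Defs.
From mathcomp Require Import all_boot all_order all_algebra.
From mathcomp Require Import reals.
From mathcomp Require Import ring lra.

Set Implicit Arguments.
Unset Strict Implicit.
Unset Printing Implicit Defensive.

Import Order.TTheory GRing.Theory Num.Theory.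
Local Open Scope ring_scope.

(* View the columns as edges and the rows as vertices of a multigraph, and let F
   be the set of edges on which w is fractional. Fractional edges never meet a
   vertex exactly once, and the tight constraints at a vertex impose, on
   directions supported on F, at most one linear equation. Since w is extreme,
   these equations have only the zero solution, so |F| is at most the number of
   vertices met by F; as every such vertex has F-degree at least 2, counting
   incidences gives F-degree exactly 2. Then w - 1/2, cut off to F, solves all the
   equations, so it vanishes. *)

(** * Decomposition of finite 2-regular graphs into disjoint cycles *)

Section Cycles.
Variable V : finType.
Implicit Types (W : {set V}) (g : rel V) (c p : seq V).

Lemma next_neq_prev c v :
  (2 < size c)%N -> uniq c -> v \in c -> next c v != prev c v.
Proof.
move=> sz uc vc; have [i s def_c] := rot_to vc.
rewrite -(next_rot i uc) -(prev_rot i uc) def_c.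
have : uniq (rot i c) by rewrite rot_uniq.
have : (2 < size (rot i c))%N by rewrite size_rot.
rewrite def_c; case: s {def_c} => [|a [|b s]] // _ /andP[vN /andP[aN _]].
have -> : next [:: v, a, b & s] v = a by rewrite /= eqxx.
rewrite prev_nth mem_head (memNindex vN) -last_nth.
by apply: contraNneq aN => ->; apply: (mem_last b s).
Qed.

(** The successor and predecessor of [v] on the cycle are two distinct neighbours, so 2-regularity
    leaves room for no other. Hence no edge leaves a cycle, which allows cycles to be split off one
    at a time. *)
Lemma cycle_nbrs W g c : symmetric g -> two_regular W g ->
    (forall v w, g v w -> (v \in W) && (w \in W)) ->
  simple_cycle g c -> forall v w, v \in c ->
  g v w = (w \in c) && ((next c v == w) || (next c w == v)).
Proof.
move=> gC reg gW /and3P[sz uc cyc] v w vc.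
have gn : g v (next c v) by apply: next_cycle.
have gp : g v (prev c v) by rewrite gC; apply: prev_cycle.
have vW : v \in W by case/andP: (gW _ _ gn).
have nbE : [set next c v; prev c v] = [set w in W | g v w].
  apply/eqP; rewrite eqEcard reg // cards2 next_neq_prev // andbT.
  apply/subsetP=> z; rewrite !inE => /orP[] /eqP->.
    by rewrite gn; case/andP: (gW _ _ gn) => _ ->.
  by rewrite gp; case/andP: (gW _ _ gp) => _ ->.
have -> : g v w = (w \in [set next c v; prev c v]).
  rewrite nbE inE; case gvw: (g v w); last by rewrite andbF.
  by case/andP: (gW _ _ gvw) => _ ->.
rewrite !inE; apply/idP/idP.
  case/orP=> /eqP ->; first by rewrite mem_next vc eqxx.
  by rewrite mem_prev vc next_prev // eqxx orbT.
case/andP=> wc /orP[] /eqP <-; first by rewrite eqxx.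
by rewrite prev_next // eqxx orbT.
Qed.

Lemma simple_cycle_exists W g v0 : symmetric g -> irreflexive g ->
    two_regular W g -> (forall v w, g v w -> (v \in W) && (w \in W)) ->
  v0 \in W -> exists c, simple_cycle g c.
Proof.
move=> gC gI reg gW v0W.
have other v y : v \in W -> exists2 z, g v z & z != y.
  move=> vW; have := reg _ vW; rewrite (cardsD1 y) => nb2.
  have /card_gt0P[z] : (0 < #|[set w in W | g v w] :\ y|)%N.
    by move: nb2; case: (_ \in _); case: #|_|.
  by rewrite !inE => /and3P[zy _ gvz]; exists z.
(* A simple path can be prolonged at its head, unless that closes a cycle. *)
have grow k : (exists c, simple_cycle g c) \/
    (exists x p, [/\ x \in W, path g x p, uniq (x :: p) & size p = k]).
  elim: k => [|k [IHk|[x [p [xW gp up szp]]]]]; [|by left|].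
    by right; exists v0, [::].
  (* Avoiding [head x p], the vertex after [x], keeps the walk from turning back; for empty [p] the
     default [x] costs nothing, as [g] is irreflexive. *)
  have [z gxz zy] := other x (head x p) xW.
  have zW : z \in W by case/andP: (gW _ _ gxz).
  have [zxp|zNxp] := boolP (z \in x :: p); last first.
    by right; exists z, (x :: p); split; rewrite //= ?zNxp ?szp // gC gxz.
  left; move: zxp; rewrite inE; case: eqP => [zx|_ /=]; first by rewrite zx gI in gxz.
  case: p gp up zy {szp} => // y p gp up zy; rewrite inE (negPf zy) /= => zp.
  case/splitPr: zp gp up => p1 p2 gp up; exists (x :: y :: rcons p1 z).
  rewrite -cat_rcons -cat_cons cat_path in gp.
  rewrite -cat_rcons -!cat_cons cat_uniq in up.
  case/andP: gp => gp _; case/andP: up => up _.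
  apply/and3P; split=> //; first by rewrite /= size_rcons.
  by rewrite (cycle_path x) /= last_rcons gC gxz.
(* Such a path would have [#|V| + 1] distinct vertices. *)
case: (grow #|V|) => // -[x [p [_ _ up szp]]].
by have := card_uniqP up; have := max_card (mem (x :: p)); rewrite /= szp => + eqc; rewrite eqc ltnn.
Qed.

(** Induction on the number of vertices: deleting one cycle keeps the rest 2-regular, since no edge
    joins the cycle to its complement. *)
Lemma two_regular_cycles W g : symmetric g -> irreflexive g ->
    two_regular W g -> (forall v w, g v w -> (v \in W) && (w \in W)) ->
  exists cs, disjoint_cycle_union W g cs.
Proof.
have [k leWk] := ubnP #|W|; elim: k W leWk g => // k IHk W leWk g gC gI reg gW.
have [W0|[v0 v0W]] := set_0Vmem W.
  exists [::]; split=> // [v|v w]; first by rewrite W0 inE.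
  by apply/negP=> /gW; rewrite W0 !inE.
have [c sc] := simple_cycle_exists gC gI reg gW v0W.
have nbrs := cycle_nbrs gC reg gW sc.
have /and3P[sz uc cyc] := sc.
have cW : {subset c <= W}.
  by move=> v vc; have := next_cycle cyc vc => /gW/andP[].
pose W' := W :\: [set v in c].
pose g' := [rel v w | [&& v \notin c, w \notin c & g v w]].
have gE v w : v \notin c -> w \in c -> g v w = false.
  by move=> vc wc; rewrite gC nbrs // (negPf vc).
have W'lt : (#|W'| < k)%N.
  rewrite -ltnS; apply: leq_trans leWk; rewrite ltnS; apply: proper_card.
  apply/properP; split; first exact: subsetDl.
  have c0 : nth v0 c 0 \in c by rewrite mem_nth //; apply: ltn_trans sz.
  by exists (nth v0 c 0); rewrite ?cW // !inE c0.
have [|||v w|cs [sc' uc' W'E g'E]] := IHk W' W'lt g'.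
- by move=> v w; rewrite /= gC; case: (_ \in _); case: (_ \in _).
- by move=> v; rewrite /= gI !andbF.
- move=> v; rewrite !inE => /andP[vc vW]; rewrite -(reg v vW).
  apply: eq_card => w; rewrite !inE /= vc /=.
  by case: (boolP (w \in c)) => [wc|]; rewrite ?andbT //= gE // !andbF.
- by rewrite !inE => /and3P[-> -> /gW].
have csNc v : has (fun c => v \in c) cs -> v \notin c.
  by rewrite -W'E !inE => /andP[].
exists (c :: cs); split=> /=.
- rewrite sc; apply: sub_all sc' => c' /and3P[sz' u' cyc'].
  apply/and3P; split=> //; apply: sub_cycle cyc' => v w.
  by case/and3P.
- rewrite cat_uniq uc uc' andbT; apply/hasPn => v /flattenP[c' c'cs vc'].
  by apply: csNc; apply/hasP; exists c'.
- by move=> v; rewrite -W'E !inE; case: (boolP (v \in c)) => [/cW ->|].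
- move=> v w; case: (boolP (v \in c)) => [vc|vNc] /=.
    rewrite nbrs //; set b := _ && _; case: (boolP b) => //= _; apply/esym/hasPn.
    move=> c' c'cs; apply/negP => /and3P[vc' _ _].
    have: v \notin c by apply: csNc; apply/hasP; exists c'.
    by rewrite vc.
  rewrite -g'E /= vNc; case: (boolP (w \in c)) => // wc; exact: gE.
Qed.

End Cycles.

(** * Linear systems and step sizes for perturbation arguments *)

Lemma underdetermined_system (K : fieldType) (I J : finType) (A : {set I})
    (B : {set J}) (c : I -> J -> K) : (#|B| < #|A|)%N ->
  exists d : I -> K, [/\ exists i, d i != 0, forall i, i \notin A -> d i = 0
    & forall j, j \in B -> \sum_(i in A) c i j * d i = 0].
Proof.
move=> ltBA.
(* This matrix has more rows than columns, so its left kernel is nonzero; a kernel vector extended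
   by zero off [A] is the solution. *)
pose M := \matrix_(i < #|A|, j < #|B|) c (enum_val i) (enum_val j).
have : kermx M != 0.
  by rewrite kermx_eq0 -row_leq_rank -ltnNge (leq_ltn_trans (rank_leq_col M)).
case/rowV0Pn=> v /sub_kermxP vM0 /rV0Pn[i0 vi0].
pose d i := \sum_k v 0 k *+ (enum_val k == i).
have dE k : d (enum_val k) = v 0 k.
  rewrite /d (bigD1 k) //= eqxx big1 ?addr0 // => l lk.
  by rewrite (inj_eq enum_val_inj) (negPf lk).
exists d; split; first by exists (enum_val i0); rewrite dE.
  move=> i iNA; rewrite /d big1 // => k _; case: eqP => // ki.
  by rewrite -ki enum_valP in iNA.
move=> j jB; have /rowP/(_ (enum_rank_in jB j)) := vM0.
rewrite !mxE => vMj.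
rewrite big_enum_val -[RHS]vMj; apply: eq_bigr => k _.
by rewrite !mxE enum_rankK_in // dE mulrC.
Qed.

Lemma uniform_step (K : realFieldType) (I : finType) (a b : I -> K) :
    (forall i, 0 <= a i) -> (forall i, a i = 0 -> b i = 0) ->
  exists2 e : K, 0 < e & forall i, e * `|b i| <= a i.
Proof.
(* Terms with [a i = 0] are zero, since [b i] vanishes there. The step is [(1 + s)^-1], where the
   added 1 keeps it positive even if [s = 0]. *)
move=> a0 ab; pose s := \sum_i `|b i| / a i.
have t0 i : 0 <= `|b i| / a i by rewrite divr_ge0.
have s0 : 0 < 1 + s by rewrite ltr_wpDr // sumr_ge0.
exists (1 + s)^-1; first by rewrite invr_gt0.
move=> i; rewrite mulrC ler_pdivrMr //.
have [ai0|ai0] := eqVneq (a i) 0; first by rewrite ai0 ab // normr0 mul0r.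
have aip : 0 < a i by rewrite lt_neqAle eq_sym ai0 a0.
rewrite -ler_pdivrMl // mulrC; apply: (@le_trans _ _ s).
  by rewrite /s (bigD1 i) //= lerDl sumr_ge0.
by rewrite lerDr.
Qed.

(** * Fractional coordinates of extreme points of the polytope *)

Section Polytope.
Variables (R : realType) (m n : nat) (H : 'M['F_2]_(m, n)).
Implicit Types (f d w : 'rV[R]_n) (u : 'I_m) (S T : {set 'I_n}).

(* Summed over N(u), these are the coordinatewise distances of [f] to the
   vertex 1_S of the cube; the constraint of [S] at [u] says that the sum is at
   least 1. *)
Definition dist_to S f (x : 'I_n) : R := if x \in S then 1 - f 0 x else f 0 x.

Definition odd_subset u S := (S \subset check_nbhd H u) && odd #|S|.

Definition tight w u S :=
  odd_subset u S && (\sum_(x in check_nbhd H u) dist_to S w x == 1).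

Lemma sum_dist_to u S f : S \subset check_nbhd H u ->
  \sum_(x in S) f 0 x + \sum_(x in check_nbhd H u :\: S) (1 - f 0 x)
    = #|check_nbhd H u|%:R - \sum_(x in check_nbhd H u) dist_to S f x.
Proof.
move=> sSN; rewrite -sum1_card natr_sum -sumrB [in RHS](big_setID S) /=.
rewrite (setIidPr sSN); congr (_ + _); apply: eq_bigr => x.
  by rewrite /dist_to => ->; rewrite opprB addrC subrK.
by rewrite !inE /dist_to => /andP[/negPf-> _].
Qed.

Lemma fundamental_polytopeE f : fundamental_polytope H f <->
  (forall x, 0 <= f 0 x <= 1) /\
  (forall u S, odd_subset u S -> 1 <= \sum_(x in check_nbhd H u) dist_to S f x).
Proof.
split=> -[f01 fH]; split=> // u S.
  by case/andP=> sSN oS; have := fH u S sSN oS; rewrite sum_dist_to // lerD2l lerN2.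
by move=> sSN oS; rewrite sum_dist_to // lerD2l lerN2; apply: fH; rewrite /odd_subset sSN.
Qed.

Lemma dist_toD S f d (e : R) x :
  dist_to S (f + e *: d) x = dist_to S f x + e * ((-1) ^+ (x \in S) * d 0 x).
Proof. by rewrite /dist_to !mxE; case: (x \in S) => /=; ring. Qed.

(* Otherwise [w] is the midpoint of [w + e d] and [w - e d], which lie in the
   polytope for small [e]. *)
Lemma extreme_point_rigid w d : lp_pseudocodeword H w ->
    (forall x, w 0 x = 0 \/ w 0 x = 1 -> d 0 x = 0) ->
    (forall u S, tight w u S ->
       \sum_(x in check_nbhd H u) (-1) ^+ (x \in S) * d 0 x = 0) ->
  d = 0.
Proof.
move=> [/fundamental_polytopeE[w01 wH] ext] dint dtight.
pose dir u S := \sum_(x in check_nbhd H u) (-1) ^+ (x \in S) * d 0 x.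
pose slack u S := \sum_(x in check_nbhd H u) dist_to S w x - 1.
(* All constraints are indexed together: [a] holds their slacks at [w], and [b] their rates of
   change along [d] up to sign. Sets that are not odd subsets get the harmless values 1 and 0. *)
pose a (i : 'I_n * bool + 'I_m * {set 'I_n}) : R := match i with
  | inl (x, b) => if b then 1 - w 0 x else w 0 x
  | inr (u, T) => if odd_subset u T then slack u T else 1 end.
pose b (i : 'I_n * bool + 'I_m * {set 'I_n}) : R := match i with
  | inl (x, b) => d 0 x
  | inr (u, T) => if odd_subset u T then dir u T else 0 end.
have a0 i : 0 <= a i.
  case: i => [[x []]|[u S]] /=; first by have := w01 x; lra.
    by case/andP: (w01 x).
  by case: ifP => // oS; rewrite subr_ge0; apply: wH.
have ab i : a i = 0 -> b i = 0.
  case: i => [[x []]|[u S]] /=.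
  - by move=> h; apply: dint; right; lra.
  - by move=> h; apply: dint; left.
  case: ifP => // oS /eqP; rewrite subr_eq0 => tS; apply: dtight.
  by rewrite /tight oS.
have [e e0 eab] := uniform_step a0 ab.
have inP (t : R) : `|t| = e -> fundamental_polytope H (w + t *: d).
  move=> te; apply/fundamental_polytopeE.
  have tb i : - a i <= t * b i <= a i.
    by rewrite -ler_norml normrM te.
  split=> [x|u S oS].
    by have := tb (inl (x, true)); have := tb (inl (x, false)); rewrite !mxE /=; lra.
  under eq_bigr do rewrite dist_toD.
  rewrite big_split /= -mulr_sumr.
  by have := tb (inr (u, S)); rewrite /= oS /slack /dir; lra.
have [] := ext (w + e *: d) (w + (- e) *: d) 2^-1.
- by apply: inP; rewrite gtr0_norm.
- by apply: inP; rewrite normrN gtr0_norm.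
- by lra.
- by apply/rowP=> x; rewrite !mxE; field.
move=> /eqP; rewrite -subr_eq0 addrAC subrr add0r scaler_eq0 (gt_eqF e0) /=.
by move=> /eqP.
Qed.

Definition fractional w : {set 'I_n} := [set x | 0 < w 0 x < 1].

(** The two tight sums add up to 2. Each coordinate in the symmetric difference of [S] and [T]
    contributes exactly 1, and this set is nonempty of even size, so it uses up the whole total. A
    fractional coordinate outside it would contribute a further positive amount. *)
Lemma tight_pair w u S T : fundamental_polytope H w ->
    tight w u S -> tight w u T -> S != T ->
  forall x, x \in check_nbhd H u -> x \in fractional w ->
  (x \in S) != (x \in T).
Proof.
move=> [w01 _] /andP[/andP[sSN oS] /eqP tS] /andP[/andP[sTN oT] /eqP tT] neST.
set N := check_nbhd H u in sSN sTN tS tT *.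
pose D := (S :\: T) :|: (T :\: S).
have DE x : (x \in D) = ((x \in S) != (x \in T)).
  by rewrite !inE; case: (x \in S); case: (x \in T).
have sDN : D \subset N by rewrite subUset !subDset !subsetU ?sSN ?sTN ?orbT.
have D2 : (1 < #|D|)%N.
  have D0 : D != set0.
    apply: contraNneq neST => D0; apply/eqP/setP=> x.
    by apply/eqP; rewrite -[_ == _]negbK -DE D0 inE.
  have oD : ~~ odd #|D|.
    have dis : [disjoint S :\: T & T :\: S].
      by rewrite -setI_eq0; apply/eqP/setP=> x; rewrite !inE; case: (x \in S); case: (x \in T).
    rewrite /D cardsU disjoint_setI0 // cards0 subn0 oddD.
    move: oS oT; rewrite -(cardsID T S) -(cardsID S T) setIC !oddD.
    by do 3!case: (odd _).
  by move: D0 oD; rewrite -cards_eq0; case: #|D| => [|[]].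
move=> x xN; rewrite inE -DE => xF; apply: contraT => xD.
have d0 U y : 0 <= dist_to U w y.
  by rewrite /dist_to; case: ifP => _; have := w01 y; lra.
have : \sum_(y in N) (dist_to S w y + dist_to T w y) = 2.
  by rewrite big_split /= tS tT; lra.
rewrite (big_setID D) /= (setIidPr sDN) (eq_bigr (fun=> 1)); last first.
  by move=> y; rewrite DE /dist_to; case: (y \in S); case: (y \in T) => // _; lra.
rewrite sumr_const (bigD1 x) /=; last by rewrite in_setD xD xN.
have : 2 <= #|D|%:R :> R by rewrite ler_nat.
set s := \sum_(i in _ | _) _; have s0 : 0 <= s by apply: sumr_ge0 => y _; rewrite addr_ge0.
have : 0 < dist_to S w x + dist_to T w x.
  by rewrite /dist_to; case: (x \in S); case: (x \in T); lra.
lra.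
Qed.

(* With a single fractional coordinate [a] at [u], rounding [a] so that the
   support gets odd size gives a constraint that [w] violates. *)
Lemma card_fractional_neq1 w u : fundamental_polytope H w ->
  #|check_nbhd H u :&: fractional w| != 1%N.
Proof.
move=> /fundamental_polytopeE[w01 wH]; apply/negP=> /cards1P[a Fa].
have : a \in [set a] by rewrite set11.
rewrite -Fa in_setI [_ \in fractional w]inE => /andP[aN aF].
pose S0 := [set x in check_nbhd H u | w 0 x == 1].
have aS0 : a \notin S0 by rewrite inE aN; case: eqP aF => // ->; rewrite ltxx andbF.
have sS0 : S0 \subset check_nbhd H u by apply/subsetP=> x; rewrite inE => /andP[].
have [S [oS SE]] : exists S, odd_subset u S /\ forall x, x != a -> (x \in S) = (x \in S0).
  case: (boolP (odd #|S0|)) => o0; first by exists S0; rewrite /odd_subset sS0.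
  exists (a |: S0); split; last by move=> x xa; rewrite !inE (negPf xa).
  by rewrite /odd_subset subUset sub1set aN sS0 cardsU1 aS0 /= o0.
have := wH u S oS; rewrite (bigD1 a) /=; last exact: aN.
rewrite big1 => [|x /andP[xN xa]]; last first.
  have : x \notin [set a] by rewrite inE.
  rewrite -Fa in_setI xN [_ \in fractional w]inE /dist_to SE // [in x \in _]inE xN /= => xF.
  by have := w01 x; case: eqP => [->|/eqP w1]; lra.
by rewrite /dist_to; case: ifP; lra.
Qed.

Lemma mem_check_nbhd u x : (x \in check_nbhd H u) = (H u x == 1).
Proof. by rewrite !inE. Qed.

Lemma notin_fractional w x : fundamental_polytope H w ->
  x \notin fractional w -> w 0 x = 0 \/ w 0 x = 1.
Proof.
move=> [w01 _]; rewrite inE => xF; have := w01 x.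
have [->|w0] := eqVneq (w 0 x) 0; first by left.
have [->|w1] := eqVneq (w 0 x) 1; first by right.
by rewrite !le_eqVlt eq_sym (negPf w0) (negPf w1) /= (negPf xF).
Qed.

Definition fractional_checks w : {set 'I_m} :=
  [set u | check_nbhd H u :&: fractional w != set0].

(* By [tight_pair], modulo the integral coordinates all tight constraints at a
   check amount to a single linear equation. *)
Lemma card_fractional_le w : lp_pseudocodeword H w ->
  (#|fractional w| <= #|fractional_checks w|)%N.
Proof.
move=> ext; have wP := ext.1; rewrite leqNgt; apply/negP.
(* One tight set is picked per check to supply its equation; a check without tight sets gets the
   trivial equation. *)
pose c (x : 'I_n) (u : 'I_m) : R :=
  if [pick S | tight w u S] is Some T then
    if x \in check_nbhd H u then (-1) ^+ (x \in T) else 0 else 0.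
case/(@underdetermined_system R _ _ _ _ c) => d [[x0 dx0] dF dJ].
pose v : 'rV[R]_n := \row_x d x.
suff v0 : v = 0 by move/rowP/(_ x0): v0 dx0; rewrite !mxE => ->; rewrite eqxx.
apply: (extreme_point_rigid ext) => [x wx|u T tT].
  by rewrite mxE dF // inE; case: wx => ->; rewrite ltxx ?andbF.
have [Fu0|Fu0] := boolP (u \in fractional_checks w); last first.
  rewrite big1 // => x xN; rewrite mxE dF ?mulr0 //.
  apply: contra Fu0 => xF; rewrite inE; apply/set0Pn; exists x.
  by rewrite in_setI xN xF.
have := dJ u Fu0; rewrite /c; case: pickP => [S tS|/(_ T)]; last by rewrite tT.
have -> : \sum_(x in fractional w)
      (if x \in check_nbhd H u then (-1) ^+ (x \in S) else 0) * d x
    = \sum_(x in check_nbhd H u) (-1) ^+ (x \in S) * v 0 x.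
  rewrite big_mkcond [RHS]big_mkcond; apply: eq_bigr => x _.
  rewrite mxE; case: ifPn => xF; case: ifP => xN //; first by rewrite mul0r.
  by rewrite dF ?mulr0.
have [<- //|neST] := eqVneq S T.
(* On fractional coordinates the signs for [T] are opposite to those for [S], so the sum for [T] is
   the negative of the one for [S]. *)
move=> S0; apply/eqP; rewrite -oppr_eq0 -sumrN; apply/eqP.
rewrite -[RHS]S0; apply: eq_bigr => x xN; rewrite mxE.
have [xF|xF] := boolP (x \in fractional w); last by rewrite dF // !mulr0 oppr0.
have := tight_pair wP tS tT neST xN xF.
by case: (x \in S); case: (x \in T) => //= _; ring.
Qed.

(** With [F] the fractional columns and [J] the fractional checks, double counting gives [2|F| =
    \sum_(v in J) deg v >= 2|J| >= 2|F|], so every degree in the sum attains its lower bound 2. *)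
Lemma card_fractional_check w u : is_cycle_code H -> lp_pseudocodeword H w ->
  u \in fractional_checks w -> #|check_nbhd H u :&: fractional w| = 2%N.
Proof.
move=> cycH ext uJ; have wP := ext.1.
pose deg v := #|check_nbhd H v :&: fractional w|.
have deg2 v : v \in fractional_checks w -> (2 <= deg v)%N.
  rewrite inE -cards_eq0 => d0; have := card_fractional_neq1 v wP.
  by rewrite /deg; move: d0; case: #|_| => [|[]].
have handshake : (#|fractional w| * 2 = \sum_(v in fractional_checks w) deg v)%N.
  transitivity (\sum_v deg v)%N; last first.
    rewrite (bigID [in fractional_checks w]) /= [X in (_ + X)%N]big1 ?addn0 //.
    by move=> v; rewrite inE negbK -cards_eq0 => /eqP.
  rewrite -sum_nat_const.
  rewrite (eq_bigr (fun x => \sum_(v | H v x == 1%R) 1)%N); last first.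
    by move=> x _; rewrite sum1dep_card cycH.
  rewrite (exchange_big_dep predT) //=; apply: eq_bigr => v _.
  rewrite sum1dep_card; apply: eq_card => x.
  by rewrite in_setI mem_check_nbhd inE andbC.
have /leqif_sum[le eqs] : forall v, v \in fractional_checks w ->
    (2 <= deg v ?= iff (2 == deg v))%N by move=> v /deg2; apply: leqif_eq.
have : \sum_(v in fractional_checks w) 2 == (\sum_(v in fractional_checks w) deg v)%N.
  by rewrite eqn_leq le -handshake sum_nat_const leq_mul2r card_fractional_le.
by rewrite eqs => /forall_inP/(_ u uJ)/eqP.
Qed.

(* Once every check has degree 0 or 2, the deviation of [w] from 1/2 on the
   fractional coordinates is itself an admissible direction. *)
Lemma fractional_half w x : is_cycle_code H -> lp_pseudocodeword H w ->
  x \in fractional w -> w 0 x = 2^-1.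
Proof.
move=> cycH ext xF; have wP := ext.1; have w01 := wP.1.
pose d : 'rV[R]_n :=
  \row_y (if y \in fractional w then w 0 y - 2^-1 else 0).
suff /rowP/(_ x) : d = 0 by rewrite !mxE xF => /eqP; rewrite subr_eq0 => /eqP.
apply: (extreme_point_rigid ext) => [y wy|u S tS].
  by rewrite mxE inE; case: wy => ->; rewrite ltxx ?andbF.
rewrite (big_setID (fractional w)) /= [X in _ + X]big1 ?addr0; last first.
  by move=> y; rewrite in_setD => /andP[/negPf yF _]; rewrite mxE yF mulr0.
have [uJ|uJ] := boolP (u \in fractional_checks w); last first.
  by move: uJ; rewrite inE negbK => /eqP->; rewrite big_set0.
rewrite (eq_bigr (fun y => dist_to S w y - 2^-1)); last first.
  move=> y; rewrite in_setI => /andP[_ yF]; rewrite mxE yF /dist_to.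
  by case: (y \in S); rewrite /=; field.
rewrite sumrB sumr_const card_fractional_check //.
have /andP[_ /eqP sum1] := tS; rewrite (big_setID (fractional w)) /= in sum1.
(* The two fractional coordinates subtract [2 * 2^-1 = 1] in total, so the goal is that they alone
   carry the whole tight sum 1. *)
suff out0 : \sum_(y in check_nbhd H u :\: fractional w) dist_to S w y = 0.
  by move: sum1; rewrite out0 addr0 => ->; rewrite -mulr_natr; lra.
have dist_ge0 y : 0 <= dist_to S w y.
  by have := w01 y; rewrite /dist_to; case: ifP => _; lra.
apply: big1 => y yD; have [_ yF] := setDP yD.
have : u \in fractional_checks w by []; rewrite {1}inE => /set0Pn[z zI].
have zpos : 0 < dist_to S w z.
  have := zI; rewrite in_setI => /andP[_].
  by rewrite inE /dist_to; case: ifP => _; lra.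
(* An integral coordinate at distance 1 would, together with the positive distance at the fractional
   [z], push the sum above 1. *)
have [//|y1] : dist_to S w y = 0 \/ dist_to S w y = 1.
  rewrite /dist_to; case: (notin_fractional wP yF) => ->; case: ifP => _;
    by [left; lra|right; lra].
move: sum1; rewrite (bigD1 z) //= [X in _ + X](bigD1 y) //= y1.
set s := \sum_(i in _ | _) _; set t := \sum_(i in _ | _) _.
have s0 : 0 <= s by apply: sumr_ge0.
have t0 : 0 <= t by apply: sumr_ge0.
by lra.
Qed.

End Polytope.

(** * From fractional coordinates to the induced subgraph *)

Theorem mainTheorem1 (R : realType) (m n : nat) (H : 'M['F_2]_(m, n))
    (w : 'rV[R]_n) (cycH : is_cycle_code H) (extw : lp_pseudocodeword H w) :
  (forall x : 'I_n, w 0 x \in [:: 0; 2^-1; 1]) /\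
  (let W := half_nodes m w :|: nbhds (tanner H) (half_nodes m w) in
   let Gamma := induced (tanner H) W in
   two_regular W Gamma /\
   exists gammas : seq (seq ('I_n + 'I_m)), disjoint_cycle_union W Gamma gammas).
Proof.
have wP := extw.1; split=> [x|W Gamma].
  have [xF|xF] := boolP (x \in fractional w).
    by rewrite (fractional_half cycH extw xF) !inE eqxx orbT.
  by case: (notin_fractional wP xF) => ->; rewrite !inE eqxx ?orbT.
have halfE x : (inl x \in half_nodes m w) = (x \in fractional w).
  rewrite mem_imset; last by move=> ? ? [].
  rewrite inE; apply/eqP/idP => [wx|]; last exact: fractional_half cycH extw.
  by rewrite inE wx; lra.
have half_inr u : (inr u \in half_nodes m w) = false.
  by apply/negP => /imsetP[].
have WinlE x : (inl x \in W) = (x \in fractional w).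
  rewrite inE halfE orbC; apply/orb_idl => /bigcupP[[y|u]]; last by rewrite half_inr.
  by rewrite inE.
have WinrE u : (inr u \in W) = (u \in fractional_checks H w).
  rewrite !inE half_inr /=; apply/bigcupP/set0Pn => [[[x|v]]|[x]].
  - by rewrite halfE => xF; rewrite inE => ux; exists x; rewrite in_setI mem_check_nbhd xF andbT.
  - by rewrite half_inr.
  rewrite in_setI mem_check_nbhd => /andP[ux xF].
  by exists (inl x); rewrite ?halfE // inE.
have tannerC : symmetric (tanner H) by move=> [x|u] [y|v].
have GammaE v v' : Gamma v v' = [&& v \in W, v' \in W & tanner H v v'] by [].
have GammaC : symmetric Gamma.
  by move=> v v'; rewrite !GammaE tannerC; do 2!case: (_ \in W).
have GammaI : irreflexive Gamma by move=> [x|u]; rewrite GammaE !andbF.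
have GammaW v v' : Gamma v v' -> (v \in W) && (v' \in W) by case/and3P => -> ->.
have reg : two_regular W Gamma.
  move=> [x|u] vW; have := vW.
    (* Both checks of a fractional column lie in [W], so a variable node keeps its full Tanner
       degree 2. *)
    rewrite WinlE => xF; rewrite -(cycH x).
    rewrite -(card_imset _ (@inr_inj 'I_n 'I_m)); apply: eq_card => -[y|u].
      by rewrite inE GammaE !andbF; apply/esym/negP => /imsetP[].
    rewrite mem_imset; last exact: inr_inj.
    rewrite inE GammaE vW /= [in RHS]inE WinrE; case ux: (H u x == 1); rewrite ?andbF //.
    rewrite andbT andbb inE; apply/set0Pn; exists x.
    by rewrite in_setI mem_check_nbhd ux.
  (* A check node keeps only its fractional columns, of which there are exactly two. *)
  rewrite WinrE => uJ; rewrite -(card_fractional_check cycH extw uJ).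
  rewrite -(card_imset _ (@inl_inj 'I_n 'I_m)); apply: eq_card => -[y|v]; last first.
    by rewrite inE GammaE !andbF; apply/esym/negP => /imsetP[].
  rewrite mem_imset; last exact: inl_inj.
  by rewrite inE GammaE vW /= in_setI mem_check_nbhd WinlE andbA andbb andbC.
by split=> //; apply: two_regular_cycles.
Qed.
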